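(* Let $q$ be a prime power. If $\mathcal{F} \subset \mathrm{GL}_2(\mathbb{F}_q)$ is intersecting, then $\mathcal{F}$ is contained in a coset of the stabilizer in $\mathrm{GL}_2(\mathbb{F}_q)$ of a point of $\Omega_q$, or in a coset of the (setwise) stabilizer in $\mathrm{GL}_2(\mathbb{F}_q)$ of a line of $\mathcal{O}_2$.
   Context: $\mathrm{GL}_2(\mathbb{F}_q)$ acts by left multiplication on $\Omega_q := \mathbb{F}_q^2\setminus\{0\}$. A subset $\mathcal{F}\subset \mathrm{GL}_2(\mathbb{F}_q)$ is intersecting if for all $A,B\in\mathcal{F}$ there exists $u\in\Omega_q$ with $Au=Bu$. $\mathcal{O}_2$ is the set of lines of the affine plane $\mathrm{AG}(2,q)$ not containing the zero vector, i.e. the sets $v+\langle u\rangle=\{v+tu \mid t\in\mathbb{F}_q\}$ with $u,v\in\mathbb{F}_q^2$ linearly independent; $\mathrm{GL}_2(\mathbb{F}_q)$ acts on $\mathcal{O}_2$ by $A(v+\langle u\rangle)=Av+\langle Au\rangle$. A coset of a subgroup $S$ is a set of the form $AS$ with $A\in\mathrm{GL}_2(\mathbb{F}_q)$. *)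

(* Defs.v *)
From HB Require Import structures.
From mathcomp Require Import all_boot all_order all_algebra all_fingroup.

Set Implicit Arguments.
Unset Strict Implicit.
Unset Printing Implicit Defensive.

Import GRing.Theory.
Local Open Scope ring_scope.

(* F_q is an arbitrary finite field F; vectors of F_q^2 are column vectors.   *)
(* MathComp group actions are right actions, so the left action of GL_2(F_q)  *)
(* on vectors is written out as a matrix product.                             *)
Definition glact (F : finFieldType) (A : {'GL_2[F]}) (w : 'cV[F]_2) : 'cV[F]_2 :=
  GLval A *m w.

Definition Omega (F : finFieldType) : {set 'cV[F]_2} := [set w | w != 0].

Definition intersecting (F : finFieldType) (S : {set {'GL_2[F]}}) : Prop :=
  forall A B : {'GL_2[F]}, A \in S -> B \in S ->
    exists2 u : 'cV[F]_2, u \in Omega F & glact A u = glact B u.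

Definition affine_line (F : finFieldType) (v u : 'cV[F]_2) : {set 'cV[F]_2} :=
  [set v + t *: u | t : F].

Definition O2 (F : finFieldType) : {set {set 'cV[F]_2}} :=
  [set L | [exists v : 'cV[F]_2, exists u : 'cV[F]_2,
             free [:: u; v] && (L == affine_line v u)]].

Definition line_act (F : finFieldType) (A : {'GL_2[F]}) (L : {set 'cV[F]_2}) :
  {set 'cV[F]_2} := [set glact A x | x in L].

Lemma line_actE (F : finFieldType) (A : {'GL_2[F]}) (v u : 'cV[F]_2) :
  line_act A (affine_line v u) = affine_line (glact A v) (glact A u).
Proof.
rewrite /line_act /affine_line -imset_comp; apply: eq_imset => t /=.
by rewrite /glact mulmxDr -scalemxAr.
Qed.

Definition point_stab (F : finFieldType) (w : 'cV[F]_2) : {set {'GL_2[F]}} :=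
  [set A | glact A w == w].

Definition line_stab (F : finFieldType) (L : {set 'cV[F]_2}) : {set {'GL_2[F]}} :=
  [set A | line_act A L == L].

Lemma glact1 (F : finFieldType) (w : 'cV[F]_2) : glact 1%g w = w.
Proof. exact: mul1mx. Qed.

Lemma glactM (F : finFieldType) (A B : {'GL_2[F]}) (w : 'cV[F]_2) :
  glact (A * B)%g w = glact A (glact B w).
Proof. by rewrite /glact mulmxA. Qed.

Lemma point_stab_group_set (F : finFieldType) (w : 'cV[F]_2) :
  group_set (point_stab w).
Proof.
apply/group_setP; split=> [|A B]; first by rewrite inE glact1.
by rewrite !inE glactM => /eqP hA /eqP ->; rewrite hA.
Qed.

Canonical point_stab_group (F : finFieldType) (w : 'cV[F]_2) :=
  Group (point_stab_group_set w).

Lemma line_stab_group_set (F : finFieldType) (L : {set 'cV[F]_2}) :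
  group_set (line_stab L).
Proof.
apply/group_setP; split=> [|A B].
  by rewrite inE /line_act (eq_imset _ (@glact1 F)) imset_id.
rewrite !inE => /eqP hA /eqP hB; apply/eqP; rewrite -[RHS]hA -[in RHS]hB.
by rewrite /line_act -imset_comp; apply: eq_imset => x /=; rewrite glactM.
Qed.

Canonical line_stab_group (F : finFieldType) (L : {set 'cV[F]_2}) :=
  Group (line_stab_group_set L).

(* Main.v *)
(* F is intersecting iff the pairwise differences of its matrices are singular.
   If M, N and M - N have rank at most one, with M and N nonzero, then M and N
   have the same row space or the same column space.  Hence, after translating
   by some A0 in F, all the differences A - A0 have a common row space or a
   common column space (up to zero).  In the first case a common kernel vector
   is fixed by all A0^-1 A; in the second, all A0^-1 A - 1 have image in one
   line <w>, so that A0^-1 A maps v + <w> into itself. *)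
Require Import Defs.
From mathcomp Require Import all_boot all_order all_algebra all_fingroup.

Set Implicit Arguments.
Unset Strict Implicit.
Unset Printing Implicit Defensive.

Import GRing.Theory.
Local Open Scope ring_scope.

Section Rank.

Variable F : fieldType.

Lemma mxrank_factor (m n r : nat) (M : 'M[F]_(m, n)) :
  \rank M = r ->
  exists a : 'M_(m, r), exists2 b : 'M_(r, n), M = a *m b &
    (b :=: M)%MS /\ (a^T :=: M^T)%MS.
Proof.
move=> <-; exists (col_base M), (row_base M); first by rewrite mulmx_base.
split; first exact: eq_row_base.
apply/eqmxP/andP; split; last by rewrite -[X in (X^T <= _)%MS]mulmx_base trmx_mul submxMl.
(* A right inverse [c] of [row_base M] gives [col_base M = M *m c], hence the second inclusion of
   column spaces. *)
have /row_freeP[c bc] := row_base_free M.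
by rewrite -[col_base M]mulmx1 -bc mulmxA mulmx_base trmx_mul submxMl.
Qed.

Lemma mxrank_eq1 (m n : nat) (M : 'M[F]_(m, n)) :
  M != 0 -> (\rank M <= 1)%N -> \rank M = 1%N.
Proof. by rewrite -mxrank_eq0; case: (\rank M) => [|[]]. Qed.

Lemma eqmx_adds_rank1 (m1 m2 n : nat) (M : 'M[F]_(m1, n)) (N : 'M[F]_(m2, n)) :
  \rank M = 1%N -> \rank N = 1%N -> (\rank (M + N)%MS <= 1)%N -> (M == N)%MS.
Proof.
move=> rM rN rMN.
have MsN := mxrank_leqif_sup (addsmxSl M N).
have NsM := mxrank_leqif_sup (addsmxSr M N).
have := MsN.2; have := NsM.2; rewrite rM rN !addsmx_sub !submx_refl /= andbT.
have -> : \rank (M + N)%MS = 1%N by apply/eqP; rewrite eqn_leq rMN -rM MsN.1.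
by move=> <- <-.
Qed.

Lemma col_mx_unit (u v : 'rV[F]_2) :
  \rank u = 1%N -> \rank v = 1%N -> ~~ (u == v)%MS ->
  (col_mx u v : 'M_2) \in unitmx.
Proof.
move=> ru rv; rewrite -row_full_unit /row_full eqn_leq rank_leq_row ltnNge /=.
by apply: contra => ruv; apply: eqmx_adds_rank1; rewrite ?addsmxE.
Qed.

(** With [M = a *m b] and [N = c *m d], the difference is the block product of [row_mx a c] and
    [col_mx b (- d)]. If both the row spaces and the column spaces differ, both factors are
    invertible and [M - N] has rank two. *)
Lemma eqmx_or_eqmx_tr (M N : 'M[F]_2) :
  M != 0 -> N != 0 -> (\rank M <= 1)%N -> (\rank N <= 1)%N ->
  (\rank (M - N)%R <= 1)%N -> (M == N)%MS || (M^T == N^T)%MS.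
Proof.
move=> M0 N0 /(mxrank_eq1 M0) rM /(mxrank_eq1 N0) rN.
have [a [b Mab [bM aM]]] := mxrank_factor rM.
have [c [d Ncd [dN cN]]] := mxrank_factor rN.
rewrite leqNgt; apply: contraR; rewrite negb_or => /andP[neR neC].
have bd : (col_mx b (- d) : 'M_2) \in unitmx.
  by apply: col_mx_unit; rewrite !(eqmx_opp d, bM, dN).
have ac : (row_mx a c : 'M_2) \in unitmx.
  rewrite -[row_mx a c]trmxK unitmx_tr tr_row_mx.
  by apply: col_mx_unit; rewrite !(aM, cN) ?mxrank_tr.
have -> : M - N = row_mx a c *m col_mx b (- d).
  by rewrite mul_row_col mulmxN -Mab -Ncd.
by rewrite mxrank_unit // unitmx_mul ac.
Qed.

End Rank.

Section Action.

Variable F : finFieldType.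
Implicit Types (A B : {'GL_2[F]}) (S : {set {'GL_2[F]}}) (u v w : 'cV[F]_2).

Lemma glact_inj A : injective (glact A).
Proof.
by apply: (can_inj (g := glact A^-1%g)) => u; rewrite -glactM mulVg glact1.
Qed.

Lemma rank_sub_intersecting S A B :
  intersecting S -> A \in S -> B \in S -> (\rank (GLval A - GLval B)%R <= 1)%N.
Proof.
move=> hS AS BS; have [u] := hS A B AS BS; rewrite inE /glact => u0 /eqP.
rewrite -subr_eq0 -mulmxBl leqNgt => /eqP Du; apply: contra u0 => rD.
have uD : GLval A - GLval B \in unitmx.
  by rewrite -row_full_unit /row_full eqn_leq rank_leq_row.
by rewrite -[u]mul1mx -(mulVmx uD) -mulmxA Du mulmx0.
Qed.

(** Supplies the base point of a line of direction [w] that misses the origin. *)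
Lemma exists_free_pair w : w != 0 -> exists v, free [:: w; v].
Proof.
move=> w0; suff /subvPn[v _ vw] : ~~ (fullv <= <[w]>)%VS.
  exists v; rewrite (perm_free (_ : perm_eq _ [:: v; w])) ?(perm_catC [:: w]) //.
  by rewrite free_cons span_seq1 vw seq1_free.
by apply/negP => /dimvS; rewrite dimvf dim_vline w0.
Qed.

(** The line is mapped into itself; injectivity and finiteness turn the inclusion into equality. *)
Lemma line_stab_transvection B v w :
  (forall x, exists s, glact B x = x + s *: w) ->
  B \in line_stab (affine_line v w).
Proof.
move=> Bw; rewrite inE eqEcard (card_imset _ (@glact_inj B)) leqnn andbT.
apply/subsetP => _ /imsetP[_ /imsetP[t _ ->] ->].
have [s ->] := Bw (v + t *: w).
by apply/imsetP; exists (t + s); rewrite // scalerDl addrA.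
Qed.

(* The degenerate case F = {A0} is covered by taking A1 = A0. *)
Lemma intersecting_common_space S A0 :
    intersecting S -> A0 \in S ->
  exists2 A1, A1 \in S &
    (forall A, A \in S -> (GLval A - GLval A0 <= GLval A1 - GLval A0)%MS)
    \/ (A1 != A0 /\ forall A, A \in S ->
         ((GLval A - GLval A0)^T <= (GLval A1 - GLval A0)^T)%MS).
Proof.
move=> hS A0S; pose D A := GLval A - GLval A0.
have D0 A : (D A == 0) = (A == A0) by rewrite subr_eq0.
have rD A : A \in S -> (\rank (D A) <= 1)%N.
  by move=> AS; apply: rank_sub_intersecting A0S.
have cmp A B : A \in S -> B \in S -> D A != 0 -> D B != 0 ->
    (D A == D B)%MS || ((D A)^T == (D B)^T)%MS.
  move=> AS BS A_0 B_0; apply: eqmx_or_eqmx_tr; rewrite ?rD //.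
  rewrite /D opprB addrA subrK; exact: rank_sub_intersecting BS.
have [/existsP[A1 /andP[A1S A10]] | ] := boolP [exists A in S, A != A0]; last first.
  rewrite negb_exists => /forallP S0; exists A0 => //; left => A AS.
  by have := S0 A; rewrite AS negbK => /eqP ->.
exists A1 => //; have DA1 : D A1 != 0 by rewrite D0.
have [/forall_inP ? | ] := boolP [forall A in S, (D A <= D A1)%MS]; first by left.
case/forall_inPn => A2 A2S nR; right; split=> // A3 A3S.
(* If the column space of [D A3] is not inside that of [D A1], these two share their row space. A
   nonzero [D A2] then has this row space too: otherwise it would share its column space with both
   and so force theirs to agree. *)
apply: contraR nR => nC; rewrite -/(D A1) -/(D A3) in nC.
have D3 : D A3 != 0 by apply: contraNneq nC => ->; rewrite trmx0 sub0mx.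
have [->|D2] := eqVneq (D A2) 0; first exact: sub0mx.
have /orP[/andP[] //|/andP[_ C12]] := cmp _ _ A2S A1S D2 DA1.
have /orP[/andP[R31 _]|/andP[C31 _]] := cmp _ _ A3S A1S D3 DA1; last first.
  by rewrite C31 in nC.
have /orP[/andP[R23 _]|/andP[_ C32]] := cmp _ _ A2S A3S D2 D3.
  exact: submx_trans R31.
have /orP[/andP[]//|/andP[C21 _]] := cmp _ _ A2S A1S D2 DA1.
by rewrite (submx_trans C32 C21) in nC.
Qed.

End Action.

Theorem theorem1p2 (F : finFieldType) (S : {set {'GL_2[F]}})
    (hS : intersecting S) :
  (exists2 w : 'cV[F]_2, w \in Omega F
     & exists A : {'GL_2[F]}, S \subset (A *: point_stab w)%g)
  \/ (exists2 L : {set 'cV[F]_2}, L \in O2 F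
     & exists A : {'GL_2[F]}, S \subset (A *: line_stab L)%g).
Proof.
have [->|[A0 A0S]] := set_0Vmem S.
  left; exists (const_mx 1); last by exists 1%g; exact: sub0set.
  by rewrite inE; apply/eqP => /matrixP/(_ 0 0)/eqP; rewrite !mxE oner_eq0.
have [A1 A1S [row_sub|[A10 col_sub]]] := intersecting_common_space hS A0S.
  (* A vector killed by [A1 - A0] is killed by every [A - A0], whose rows are combinations of those
     of [A1 - A0]. *)
  left; have [u u0 /eqP] := hS A1 A0 A1S A0S.
  rewrite -subr_eq0 -mulmxBl => /eqP Du; exists u => //; exists A0.
  apply/subsetP => A AS; rewrite mem_lcoset inE glactM.
  have /submxP[C DA] := row_sub A AS.
  have -> : glact A u = glact A0 u.
    by apply/eqP; rewrite -subr_eq0 -mulmxBl DA -mulmxA Du mulmx0.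
  by rewrite -glactM mulVg glact1.
right; have D0 : GLval A1 - GLval A0 != 0 by rewrite subr_eq0.
have [a [b Dab _]] :=
  mxrank_factor (mxrank_eq1 D0 (rank_sub_intersecting hS A1S A0S)).
(* The column [a] spans the image of [A1 - A0], so [w] spans that of [A0^-1 A1 - 1]. *)
pose w := glact A0^-1%g a.
have w0 : w != 0.
  apply: contra D0; rewrite -(mulmx0 _ (GLval A0^-1%g)) (inj_eq (@glact_inj _ _)).
  by rewrite Dab => /eqP ->; rewrite mul0mx.
have [v vw] := exists_free_pair w0.
exists (affine_line v w).
  by rewrite inE; apply/existsP; exists v; apply/existsP; exists w; rewrite vw eqxx.
exists A0; apply/subsetP => A AS; rewrite mem_lcoset.
apply: line_stab_transvection => x; have /submxP[C DA] := col_sub A AS.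
(* Since [A - A0] equals [a *m b *m C^T], it sends [x] to [a] times this 1 by 1 matrix. *)
exists ((b *m C^T *m x) 0 0); rewrite glactM.
have -> : glact A x = glact A0 x + a *m (b *m C^T *m x).
  apply/eqP; rewrite addrC -subr_eq -mulmxBl -[_ - _]trmxK DA trmx_mul trmxK Dab.
  by rewrite !mulmxA.
rewrite {1}/glact mulmxDr -/(glact _ (glact _ _)) -glactM mulVg glact1.
by rewrite {1}[b *m _ *m x]mx11_scalar mul_mx_scalar /glact -scalemxAr.
Qed.
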